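(* Let $\theta\in(0,1)$ (the Dörfler marking parameter) and $s_0>0$ be given. Then for every $\epsilon>0$ there exist $\alpha,\beta>0$, $M\in\mathbb{N}$ and $K>1$ with $$\theta-\epsilon<\tilde\theta_\star:=\frac1K<\theta,$$ such that the adaptive algorithm with optimal Dörfler marking with parameter $\theta$, applied to the indicators $\eta_{\mathcal{T}}$ with parameters $\alpha,\beta,M,K$ and started from the initial partition $\mathcal{T}_0$, fails to converge with rate $s_0$; i.e. the sequence $(\mathcal{T}_k)_k$ it generates satisfies $$\sup_{k\in\mathbb{N}}(\#\mathcal{T}_k-\#\mathcal{T}_0)^{s_0}\,\eta_{\mathcal{T}_k}(\mathcal{T}_k)=\sup_{k\in\mathbb{N}}(\#\mathcal{T}_k-\#\mathcal{T}_0)^{s_0}\,\delta(\mathcal{T}_k)=\infty .$$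
   Context: Partitions. For $M\in\mathbb{N}$, $M\ge1$, let $\Omega=(0,M+1)$ and $\mathcal{T}_0=\{[0,1],[1,2],\dots,[M,M+1]\}$. The bisection of a closed interval $[a,b]$, $a<b$, is $\mathrm{BISECT}([a,b])=\{[a,\frac{a+b}2],[\frac{a+b}2,b]\}$. A partition $\mathcal{T}_\star$ is a refinement of $\mathcal{T}$, written $\mathcal{T}_\star\ge\mathcal{T}$, if it is obtained from $\mathcal{T}$ by finitely many (possibly zero) successive steps, each replacing one element $T$ of the current partition by the two elements of $\mathrm{BISECT}(T)$. $\mathbb{T}$ is the set of all refinements of $\mathcal{T}_0$. The generation $g(T)$ of an element $T\in\mathcal{T}\in\mathbb{T}$ is defined by $g(T)=0$ if $T\in\mathcal{T}_0$ and $g(T)=g(T')+1$ if $T\in\mathrm{BISECT}(T')$. For $\mathcal{M}\subset\mathcal{T}$ set $\mathrm{REFINE}(\mathcal{T};\mathcal{M})=(\mathcal{T}\setminus\mathcal{M})\cup\bigcup_{T\in\mathcal{M}}\mathrm{BISECT}(T)$. $\#$ denotes cardinality and $|T|$ the length of $T$. Indicators. For $\mathcal{T}\in\mathbb{T}$ let $T_0(\mathcal{T})$ be the element of $\mathcal{T}$ containing the point $0$, and $g_0(\mathcal{T})=g(T_0(\mathcal{T}))$. For $A\subset\overline\Omega$ put $\mathcal{T}|_A=\{T\in\mathcal{T}: T\subset\overline A\}$. For fixed $\alpha,\beta>0$, $K>1$, the nonnegative indicators $\eta_{\mathcal{T}}(T)$, $T\in\mathcal{T}\in\mathbb{T}$,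 are defined by $$\eta_{\mathcal{T}}^2(T)=\begin{cases}2^{-\alpha g_0(\mathcal{T})-\beta\left(g(T)+\frac{m-1}{M}\right)}|T| & \text{if } T\subset[m,m+1],\ m\in\{1,\dots,M\},\\ \frac1{K-1}\,\eta_{\mathcal{T}}^2(\mathcal{T}|_{[1,M+1]}) & \text{if } T=T_0(\mathcal{T}),\\ 0&\text{otherwise,}\end{cases}$$ where $\eta_{\mathcal{T}}(\mathcal{M})\ge0$ with $\eta_{\mathcal{T}}^2(\mathcal{M})=\sum_{T\in\mathcal{M}}\eta_{\mathcal{T}}^2(T)$ for $\mathcal{M}\subset\mathcal{T}$. Moreover $\delta(\mathcal{T})\ge0$ is defined by $\delta(\mathcal{T})^2=\eta_{\mathcal{T}}^2(\mathcal{T})$. Adaptive algorithm with optimal Dörfler marking with parameter $\theta\in(0,1)$. Start from $\mathcal{T}_0$ and for $k=0,1,2,\dots$: choose a set $\mathcal{M}_k\subset\mathcal{T}_k$ of minimal cardinality among all $\mathcal{M}\subset\mathcal{T}_k$ satisfying $\theta\,\eta_{\mathcal{T}_k}^2(\mathcal{T}_k)\le\eta_{\mathcal{T}_k}^2(\mathcal{M})$, and set $\mathcal{T}_{k+1}=\mathrm{REFINE}(\mathcal{T}_k;\mathcal{M}_k)$. *)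

(* Defs.v *)
From HB Require Import structures.
From mathcomp Require Import all_boot all_order all_algebra finmap.
From mathcomp Require Import all_classical all_reals all_analysis.
Set Implicit Arguments.
Unset Strict Implicit.
Unset Printing Implicit Defensive.
Import Order.TTheory GRing.Theory Num.Theory.
Local Open Scope ring_scope.

(* An element [a, b] of a partition is encoded by its endpoints (a, b).       *)
Notation elem R := (R * R)%type.

Definition itv_of (R : realType) (T : elem R) : interval R := `[T.1, T.2].

Definition len (R : realType) (T : elem R) : R := T.2 - T.1.

Definition bisect (R : realType) (T : elem R) : {fset elem R} :=
  [fset (T.1, (T.1 + T.2) / 2); ((T.1 + T.2) / 2, T.2)]%fset.

Definition init_part (R : realType) (M : nat) : {fset elem R} :=
  [fset ((m%:R, m.+1%:R) : elem R) | m in iota 0 M.+1]%fset.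

Inductive has_gen (R : realType) (M : nat) : elem R -> nat -> Prop :=
| has_gen_init T : T \in init_part R M -> has_gen M T 0
| has_gen_bisect T' T n : has_gen M T' n -> T \in bisect T' -> has_gen M T n.+1.

(* Meaningful on the elements reachable from the initial partition, whose     *)
(* generation is unique (an element of generation n has length 2^-n).         *)
Definition gen (R : realType) (M : nat) (T : elem R) : nat :=
  xget 0%N [set n | has_gen M T n]%classic.

Definition refine (R : realType) (P D : {fset elem R}) : {fset elem R} :=
  ((P `\` D) `|` \bigcup_(T <- D) bisect T)%fset.

Definition elem0 (R : realType) (P : {fset elem R}) : elem R :=
  xget (0, 0) [set T : elem R | T \in P /\ 0 \in itv_of T]%classic.

(* The order on [interval R] is inclusion.                                    *)
Definition subpart (R : realType) (P : {fset elem R}) (A : interval R) :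
    {fset elem R} :=
  [fset T in P | (itv_of T <= A)%O]%fset.

(* Squared indicators away from T_0.  The index m : 'I_M is shifted by one:   *)
(* it stands for the subinterval [m+1, m+2], hence the summand m / M.         *)
Definition eta2_away (R : realType) (alpha beta : R) (M : nat)
    (P : {fset elem R}) (T : elem R) : R :=
  if [pick m : 'I_M | (itv_of T <= `[m.+1%:R, m.+2%:R] :> interval R)%O]
    is Some m then
    2 `^ (- alpha * (gen M (elem0 P))%:R
          - beta * ((gen M T)%:R + m%:R / M%:R)) * len T
  else 0.

(* The case T = T_0 comes first; no overlap, as T_0 contains the point 0.     *)
Definition eta2 (R : realType) (alpha beta : R) (M : nat) (K : R)
    (P : {fset elem R}) (T : elem R) : R :=
  if T == elem0 P then
    (K - 1)^-1 * \sum_(T' <- subpart P `[1, M.+1%:R])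
                    eta2_away alpha beta M P T'
  else eta2_away alpha beta M P T.

Definition eta2_sum (R : realType) (alpha beta : R) (M : nat) (K : R)
    (P D : {fset elem R}) : R :=
  \sum_(T <- D) eta2 alpha beta M K P T.

Definition eta (R : realType) (alpha beta : R) (M : nat) (K : R)
    (P D : {fset elem R}) : R :=
  Num.sqrt (eta2_sum alpha beta M K P D).

Definition delta (R : realType) (alpha beta : R) (M : nat) (K : R)
    (P : {fset elem R}) : R :=
  Num.sqrt (eta2_sum alpha beta M K P P).

Definition doerfler (R : realType) (alpha beta : R) (M : nat) (K theta : R)
    (P D : {fset elem R}) : Prop :=
  (D `<=` P)%fset /\
  theta * eta2_sum alpha beta M K P P <= eta2_sum alpha beta M K P D.

Definition optimal_marking (R : realType) (alpha beta : R) (M : nat)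
    (K theta : R) (P D : {fset elem R}) : Prop :=
  doerfler alpha beta M K theta P D /\
  forall D' : {fset elem R}, doerfler alpha beta M K theta P D' ->
    (#|` D| <= #|` D'|)%N.

(* Optimal marking sets need not be unique, so the algorithm is described by  *)
(* the sequences of partitions it may produce.                                *)
Definition adaptive_run (R : realType) (alpha beta : R) (M : nat) (K theta : R)
    (P : nat -> {fset elem R}) : Prop :=
  P 0%N = init_part R M /\
  forall k : nat, exists2 D : {fset elem R},
    optimal_marking alpha beta M K theta (P k) D & P k.+1 = refine (P k) D.

Definition rate_sup (R : realType) (s : R) (P : nat -> {fset elem R})
    (e : {fset elem R} -> R) : \bar R :=
  ereal_sup (range (fun k : nat =>
    ((#|` P k|%:R - #|` P 0%N|%:R) `^ s * e (P k))%:E)).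

(* Main.v *)
(* Take M = 1, any K with theta - epsilon < 1/K < theta, and alpha = beta small.
   Let mass be the sum of len^(1 + beta) over the elements of [1, 2]; the
   indicators there are len(T_0)^alpha times its summands.  As 1/K < theta, T_0
   alone does not satisfy the Doerfler criterion, so at least the fraction
   rho = (theta K - 1) / (K - 1) of the mass is marked, and bisection multiplies
   the marked part by 2^-beta: after k steps the mass is at most
   exp(- beta rho k / 3).  By Jensen's inequality a partition of [1, 2] of mass
   S has at least S^(-1/beta) elements, so #T_k >= exp(rho k / 3), a growth
   that does not depend on alpha and beta.  On the other hand all generations
   in T_k are at most k, so delta(T_k)^2 >= 2^-((alpha + beta) k), a decay as
   slow as we please. *)
Require Import Defs.
From mathcomp Require Import all_boot all_order all_algebra finmap.
From mathcomp Require Import all_classical all_reals all_analysis.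
From mathcomp Require Import ring lra.
Set Implicit Arguments.
Unset Strict Implicit.
Unset Printing Implicit Defensive.
Import Order.TTheory GRing.Theory Num.Theory.
Local Open Scope ring_scope.

(* Jensen's inequality for t |-> t^(-1/beta): if the lengths l sum to 1, then
   their number is at least (sum of l^(1 + beta))^(-1/beta). *)
Lemma expR_le_card (R : realType) (I : eqType) (r : seq I) (p : pred I)
    (l : I -> R) (beta x : R) :
  0 < beta -> (forall i, i \in r -> p i -> 0 < l i) ->
  \sum_(i <- r | p i) l i = 1 ->
  \sum_(i <- r | p i) l i `^ beta * l i <= expR (- (beta * x)) ->
  expR x <= \sum_(i <- r | p i) 1.
Proof.
move=> b0 l0 l1 lS.
(* Divided by [expR x * l i], this says that the convex function u^(-1/beta) lies above its tangent
   at u = 1, taken at u = e^(beta x) l_i^beta. The sum of these bounds over i gives the claim. *)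
have tangent i : i \in r -> p i ->
    expR x * (l i + beta^-1 * (l i - expR (beta * x) * (l i `^ beta * l i)))
    <= 1.
  move=> ir pi; have li := l0 _ ir pi.
  have Y0 : 0 < expR (beta * x) * l i `^ beta.
    by rewrite mulr_gt0 ?expR_gt0 ?powR_gt0.
  have h : 1 + beta^-1 * (1 - expR (beta * x) * l i `^ beta) <=
      expR (- x) / l i.
    apply: (@le_trans _ _ (1 - beta^-1 * ln (expR (beta * x) * l i `^ beta))).
      have := @le_ln1Dx R (expR (beta * x) * l i `^ beta - 1).
      rewrite [1 + _]addrC subrK => /(_ ltac:(lra)) hln.
      by rewrite lerD2l -(mulrN _ (ln _)) ler_pM2l ?invr_gt0 // lerNr opprB.
    rewrite lnM ?posrE ?expR_gt0 ?powR_gt0 // expRK ln_powR -mulrDr.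
    rewrite mulKf ?gt_eqF //.
    rewrite (le_trans (expR_ge1Dx (- (x + ln (l i))))) // opprD expRD.
    by rewrite [expR (- ln _)]expRN lnK ?posrE.
  have -> : expR x *
        (l i + beta^-1 * (l i - expR (beta * x) * (l i `^ beta * l i))) =
      expR x * l i * (1 + beta^-1 * (1 - expR (beta * x) * l i `^ beta)).
    by ring.
  rewrite (le_trans (ler_wpM2l _ h)) ?mulr_ge0 ?expR_ge0 ?(ltW li) //.
  rewrite expRN; suff -> : expR x * l i * ((expR x)^-1 / l i) = 1 by [].
  by field; rewrite !gt_eqF ?expR_gt0.
apply: le_trans (_ : \sum_(i <- r | p i) expR x * (l i + beta^-1 *
    (l i - expR (beta * x) * (l i `^ beta * l i))) <= _); last first.
  rewrite big_seq_cond [leRHS]big_seq_cond.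
  by apply: ler_sum => i /andP[]; apply: tangent.
rewrite -mulr_sumr big_split /= -mulr_sumr big_split /= sumrN -mulr_sumr l1.
rewrite ler_pMr ?expR_gt0 // lerDl mulr_ge0 ?invr_ge0 ?(ltW b0) // subr_ge0.
by rewrite -[leRHS](expRxMexpNx_1 (beta * x)) ler_pM2l ?expR_gt0.
Qed.

(** As ln 2 >= 1/2, one has 2^b >= 1 + b/2, and (1 + b/2)(1 - b/3) = 1 + b(1 - b)/6 >= 1 when b <=
    1. A loss linear in b is what later cancels the exponent 1/b from Jensen's inequality. *)
Lemma powR2N_le (R : realType) (b : R) : 0 < b <= 1 -> 2 `^ (- b) <= 1 - b / 3.
Proof.
move=> /andP[b0 b1].
have h : 1 + b / 2 <= 2 `^ b.
  rewrite /powR pnatr_eq0 /=; apply: le_trans (expR_ge1Dx _).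
  rewrite lerD2l ler_pM2l //.
  have := @le_ln1Dx R (- 2^-1); have -> : 1 - 2^-1 = 2^-1 :> R by lra.
  by rewrite lnV ?posrE // lerN2; apply; lra.
rewrite powRN; apply: (@le_trans _ _ (1 + b / 2)^-1).
  by rewrite lef_pV2 // posrE; nra.
rewrite -div1r ler_pdivrMr; nra.
Qed.

(** * Dyadic elements and their generations, for M = 1 *)

Section Dyadic.
Context {R : realType}.
Implicit Types (T U V : elem R) (P D : {fset elem R}).

Lemma bisectP T U : reflect
  (U = (T.1, (T.1 + T.2) / 2) \/ U = ((T.1 + T.2) / 2, T.2)) (U \in bisect T).
Proof. by rewrite !inE; apply: (iffP orP) => -[/eqP|/eqP]; tauto. Qed.

Lemma init_partP T : T \in init_part R 1 -> T = (0, 1) \/ T = (1, 2).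
Proof.
by move/imfsetP => [m /=]; rewrite !inE => /orP[/eqP->|/eqP->] ->; [left|right].
Qed.

(** By the last clause no element straddles the point 1, so the test [1 <= T.1] can stand for
    membership in [1, 2] from here on. *)
Lemma has_gen_itv T n : has_gen 1 T n ->
  [/\ len T = 2^-1 ^+ n, 0 <= T.1, T.2 <= 2 & T.2 <= 1 \/ 1 <= T.1].
Proof.
elim=> [U /init_partP[]->|U V {}n _ [] lU U1 U2 U12 /bisectP]; rewrite /len /=.
- by rewrite subr0 expr0; split => //; [lra|left].
- by rewrite expr0; split => //; [lra|right].
have := exprn_gt0 n (_ : 0 < 2^-1 :> R); rewrite invr_gt0 => /(_ ltac:(by [])).
move: lU; rewrite /len exprS => <- U0.
by case=> -> /=; split; lra.
Qed.

(** The length 2^-n determines n, so the choice made by [xget] is forced. *)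
Lemma genE T n : has_gen 1 T n -> gen 1 T = n.
Proof.
move=> Tn; have /has_gen_itv[lT _ _ _] := Tn.
have : has_gen 1 T (gen 1 T).
  exact: (@xgetI _ 0%N [set n | has_gen 1 T n]%classic n).
move=> /has_gen_itv[]; rewrite lT => /eqP + _ _ _.
by move/eqP/ieexprIn => -> //; lra.
Qed.

Definition nonoverlap P := forall T U, T \in P -> U \in P -> T <> U ->
  T.2 <= U.1 \/ U.2 <= T.1.

Lemma refineP P D U : reflect
  ((U \in P /\ U \notin D) \/ exists2 T, T \in D & U \in bisect T)
  (U \in refine P D).
Proof.
rewrite /refine in_fsetU; apply: (iffP orP) => -[].
- by rewrite inE => /andP[? ?]; left.
- by case/bigfcupP => T /andP[TD _] TU; right; exists T.
- by case=> UP UD; left; rewrite inE UP UD.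
- by case=> T TD TU; right; apply/bigfcupP; exists T; rewrite ?TD.
Qed.

Lemma bisect_sub T U : 0 < len T -> U \in bisect T ->
  [/\ T.1 <= U.1, U.2 <= T.2 & 0 < len U].
Proof. by rewrite /len => T0 /bisectP[]-> /=; split; lra. Qed.

Lemma bisect_nonoverlap T : nonoverlap (bisect T).
Proof. by move=> U V /bisectP[]-> /bisectP[]-> //= _; [left|right]. Qed.

(** * Refinement of families of nonoverlapping elements *)

Section Refine.
Variables P D : {fset elem R}.
Hypotheses (P_gt0 : forall T, T \in P -> 0 < len T) (P_no : nonoverlap P)
  (DP : (D `<=` P)%fset).

Lemma refine_nonoverlap : nonoverlap (refine P D).
Proof.
have parent U : U \in refine P D -> exists T,
    [/\ T \in P, T.1 <= U.1, U.2 <= T.2 &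
      (U = T /\ T \notin D) \/ U \in bisect T /\ T \in D].
  case/refineP => [[UP UD]|[T TD UT]]; first by exists U; split => //; left.
  have TP := fsubsetP DP _ TD; have [? ? _] := bisect_sub (P_gt0 TP) UT.
  by exists T; split => //; right.
move=> U V /parent[T [TP T1 T2 UT]] /parent[T' [TP' T1' T2' VT]] UV.
have [TT'|/eqP /(P_no TP TP')[TT'|TT']] := eqVneq T T'; last 2 first.
- by left; exact: le_trans (le_trans T2 TT') T1'.
- by right; exact: le_trans (le_trans T2' TT') T1.
move: VT; rewrite -TT'; case: UT => -[UT TD] [] [VT] TD'.
- by case: UV; rewrite UT VT.
- by rewrite TD' in TD.
- by rewrite TD in TD'.
- exact: bisect_nonoverlap UT VT UV.
Qed.

(** Elements of positive length that do not overlap have disjoint sets of children, and no child is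
    a retained element. Hence sums change parent by parent; this serves both for total length and
    for mass. *)
Lemma sum_refine (p : pred (elem R)) (f : elem R -> R) :
  \sum_(T <- refine P D | p T) f T =
  \sum_(T <- P | p T) f T +
  \sum_(T <- D) (\sum_(U <- bisect T | p U) f U - (if p T then f T else 0)).
Proof.
rewrite !(big_mkcond p).
under [X in _ = _ + X]eq_bigr do rewrite big_mkcond.
set g := fun T => if p T then f T else 0.
set B := (\bigcup_(T <- D) bisect T)%fset.
have disjB T : T \in B -> T \notin (P `\` D)%fset.
  move=> /bigfcupP[U /andP[UD _] TU]; apply/negP; rewrite inE => /andP[TD TP].
  have UP := fsubsetP DP _ UD; have [? ? T0] := bisect_sub (P_gt0 UP) TU.
  have TU' : T <> U by move=> TU'; rewrite TU' UD in TD.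
  by move: T0; rewrite /len; case: (P_no TP UP TU') => ?; lra.
rewrite (big_fsetID _ (mem B)) /= (eq_fbigl _ (B := B)); last first.
  by move=> T; rewrite !inE /= -/B; case: (T \in B); rewrite ?andbF // orbT.
rewrite [X in _ + X](eq_fbigl _ (B := (P `\` D)%fset)); last first.
  move=> T; rewrite in_fset !inE /= -/B; have := disjB T; rewrite !inE.
  by case: (T \in B) => //= [/(_ isT)/negPf->|_]; rewrite ?andbT ?orbF.
rewrite partition_disjoint_bigfcup; last first.
  move=> T U TD UD /eqP TU.
  have TP := fsubsetP DP _ TD; have UP := fsubsetP DP _ UD.
  apply/fdisjointP => V VT; apply/negP => VU.
  have [? ? V0] := bisect_sub (P_gt0 TP) VT.
  have [? ? _] := bisect_sub (P_gt0 UP) VU.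
  by move: V0; rewrite /len; case: (P_no TP UP TU) => ?; lra.
rewrite sumrB [X in _ = X + _](big_fsetID _ (mem D)) /=.
rewrite [X in _ = X + _ + _](eq_fbigl _ (B := D)); last first.
  by move=> T; rewrite !inE /= andb_idl // => /(fsubsetP DP).
rewrite [X in _ = _ + X + _](eq_fbigl _ (B := (P `\` D)%fset)); last first.
  by move=> T; rewrite !inE /= andbC.
by rewrite [RHS]addrC addrA subrK.
Qed.
End Refine.

(** * Invariants of the partition after k steps *)

(** The index k bounds the generations, hence lengths are at least 2^-k. That [1, 2] is covered is
    recorded as total length 1, the form in which Jensen's inequality takes it. *)
Record valid k P : Prop := Valid {
  valid_gen : forall T, T \in P -> exists2 n, (n <= k)%N & has_gen 1 T n;
  valid_nonoverlap : nonoverlap P;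
  valid_elem0 : exists2 T, T \in P & T.1 = 0;
  valid_len : \sum_(T <- P | 1 <= T.1) len T = 1 }.

Lemma valid_len_ge k P T : valid k P -> T \in P -> 2^-1 ^+ k <= len T.
Proof.
move=> vP /(valid_gen vP)[n nk /has_gen_itv[-> _ _ _]].
by rewrite ler_wiXn2l // ?invr_ge0 // invf_le1 // ler1n.
Qed.

Lemma valid_len_gt0 k P T : valid k P -> T \in P -> 0 < len T.
Proof.
move=> vP TP; apply: lt_le_trans (valid_len_ge vP TP).
by rewrite exprn_gt0 // invr_gt0.
Qed.

(** Both halves lie on the same side of 1 as T. The function f is the identity for total length and
    l^(1 + beta) for mass. *)
Lemma sum_bisect k P (f : R -> R) T : valid k P -> T \in P ->
  \sum_(U <- bisect T | 1 <= U.1) f (len U) =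
  if 1 <= T.1 then f (len T / 2) *+ 2 else 0.
Proof.
move=> vP TP; have T0 := valid_len_gt0 vP TP.
have [n _ /has_gen_itv[_ T1 T2 T12]] := valid_gen vP TP.
rewrite big_mkcond /bisect big_fsetU1 ?big_seq_fset1 /=; last first.
  rewrite inE xpair_eqE negb_and; apply/orP; left.
  by move: T0; rewrite /len; apply: contraTneq; lra.
have -> : len (T.1, (T.1 + T.2) / 2) = len T / 2 by rewrite /len /=; lra.
have -> : len ((T.1 + T.2) / 2, T.2) = len T / 2 by rewrite /len /=; lra.
have -> : (1 <= (T.1 + T.2) / 2) = (1 <= T.1).
  by move: T0; rewrite /len => T0; apply/idP/idP => ?; lra.
by case: ifP => _; rewrite ?addr0 // mulr2n.
Qed.

Lemma valid_init : valid 0 (init_part R 1).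
Proof.
have E : init_part R 1 = [fset (0, 1); (1, 2)]%fset.
  apply/fsetP => T; apply/idP/idP => [/init_partP[]->|].
  - by rewrite !inE eqxx.
  - by rewrite !inE eqxx orbT.
  rewrite !inE => /orP[]/eqP->; apply/imfsetP; [exists 0%N|exists 1%N] => //.
split.
- by move=> T TP; exists 0%N => //; constructor.
- by move=> T U /init_partP[]-> /init_partP[]-> //= _; [left|right].
- by exists (0, 1) => //; rewrite E !inE eqxx.
- rewrite big_mkcond E big_fsetU1 ?big_seq_fset1 /=; last first.
    by rewrite inE xpair_eqE negb_and eq_sym oner_eq0.
  by rewrite ler10 lexx /len /=; lra.
Qed.

Lemma valid_refine k P D : valid k P -> (D `<=` P)%fset ->
  valid k.+1 (refine P D).
Proof.
move=> vP DP; have P0 T (TP : T \in P) := valid_len_gt0 vP TP.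
split.
- move=> U /refineP[[/(valid_gen vP)[n nk Un] _]|[T TD UT]].
    by exists n => //; exact: leqW.
  have [n nk Tn] := valid_gen vP (fsubsetP DP _ TD).
  by exists n.+1 => //; exact: has_gen_bisect Tn UT.
- exact: refine_nonoverlap P0 (valid_nonoverlap vP) DP.
- have [T TP T0] := valid_elem0 vP.
  have [TD|TD] := boolP (T \in D); last by exists T => //; apply/refineP; left.
  exists (T.1, (T.1 + T.2) / 2) => //; apply/refineP; right; exists T => //.
  by apply/bisectP; left.
- rewrite sum_refine //; last exact: valid_nonoverlap vP.
  rewrite (valid_len vP) big_seq big1 ?addr0 // => T TD.
  rewrite (sum_bisect id vP (fsubsetP DP _ TD)).
  case: ifP => _; last by rewrite subrr.
  by rewrite /=; lra.
Qed.

(** * Indicators and Dörfler marking in terms of mass *)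

Definition mass (beta : R) P := \sum_(T <- P | 1 <= T.1) len T `^ beta * len T.

Lemma elem0P k P : valid k P -> elem0 P \in P /\ (elem0 P).1 <= 0.
Proof.
move=> vP; rewrite /elem0; set A := (X in xget _ X).
suff: A (xget (0, 0) A) by case=> AP /itvP h; split; rewrite // h.
apply: xgetPex; have [T TP T0] := valid_elem0 vP; exists T; split => //.
have := valid_len_gt0 vP TP; rewrite /len T0 subr0 => T2.
by rewrite /itv_of in_itv /= T0 lexx ltW.
Qed.

Lemma len_powR T n a : has_gen 1 T n -> 2 `^ (- a * n%:R) = len T `^ a.
Proof.
move=> /has_gen_itv[-> _ _ _].
by rewrite mulNr -mulrN mulrC powRrM powR_invn // exprVn.
Qed.

(** For M = 1 the only index is m = 0, so the summand m / M vanishes, and powers of 2^-g become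
    powers of lengths. *)
Lemma eta2_awayE k alpha beta P T : valid k P -> T \in P ->
  eta2_away alpha beta 1 P T =
  if 1 <= T.1 then len (elem0 P) `^ alpha * (len T `^ beta * len T) else 0.
Proof.
move=> vP TP; have [n _ Tn] := valid_gen vP TP.
have [m _ Em] := valid_gen vP (elem0P vP).1.
have [_ _ T2 _] := has_gen_itv Tn.
have sub (i : 'I_1) :
    (itv_of T <= `[i.+1%:R, i.+2%:R] :> interval R)%O = (1 <= T.1).
  by rewrite ord1 /itv_of subitvE !bnd_simp T2 andbT.
rewrite /eta2_away; case: pickP => [i|/(_ ord0)]; rewrite sub => -> //.
rewrite ord1 (genE Tn) (genE Em) mul0r addr0 powRD ?pnatr_eq0 ?implybT //.
by rewrite -[- (_ * _)]mulNr (len_powR _ Em) (len_powR _ Tn) mulrA.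
Qed.

Lemma eta2_sumE k alpha beta K P D : valid k P -> (D `<=` P)%fset ->
  eta2_sum alpha beta 1 K P D = len (elem0 P) `^ alpha *
   ((if elem0 P \in D then (K - 1)^-1 * mass beta P else 0) + mass beta D).
Proof.
move=> vP DP; have [EP E0] := elem0P vP.
have sumE (A : {fset elem R}) : (A `<=` P)%fset ->
    \sum_(T <- A) eta2_away alpha beta 1 P T =
    len (elem0 P) `^ alpha * mass beta A.
  move=> AP; rewrite /mass mulr_sumr [RHS]big_mkcond big_seq [RHS]big_seq.
  by apply: eq_bigr => T /(fsubsetP AP) TP; rewrite (eta2_awayE _ _ vP TP).
have S : \sum_(T <- subpart P `[1, 2%:R]) eta2_away alpha beta 1 P T =
    len (elem0 P) `^ alpha * mass beta P.
  rewrite -sumE //; apply: big_fset_incl.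
    by apply/fsubsetP => T; rewrite !inE => /andP[].
  move=> T TP; rewrite !inE TP /= => hT; rewrite (eta2_awayE _ _ vP TP).
  have [n _ /has_gen_itv[_ _ T2 _]] := valid_gen vP TP.
  by move: hT; rewrite /itv_of subitvE !bnd_simp T2 andbT => /negPf->.
rewrite /eta2_sum mulrDr -(sumE D) //.
have [ED|ED] := ifPn.
  rewrite !(big_fsetD1 (elem0 P) ED) /= {1}/eta2 eqxx S (eta2_awayE _ _ vP EP).
  (* T_0 starts at or left of 0, so it carries no mass itself. *)
  rewrite ifN ?add0r; last by rewrite -ltNge; lra.
  rewrite mulrCA; congr (_ + _).
  by apply: eq_fbigr => T; rewrite !inE /eta2 => /andP[/negPf->].
rewrite mulr0 add0r; apply: eq_fbigr => T TD; rewrite /eta2 ifN //.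
by apply: contraNneq ED => <-.
Qed.

(** The factor len(T_0)^alpha cancels. The total is then K / (K - 1) times the mass, and T_0
    supplies at most 1 / (K - 1) times the mass, so the rest of the fraction theta must come from
    marked elements in [1, 2]. *)
Lemma doerfler_mass k alpha beta K theta P D : 1 < K -> K^-1 < theta ->
  valid k P -> doerfler alpha beta 1 K theta P D ->
  (theta * K - 1) / (K - 1) * mass beta P <= mass beta D.
Proof.
move=> K1 Kt vP [DP].
have [EP _] := elem0P vP.
have m0 : 0 <= mass beta P.
  rewrite /mass big_seq_cond sumr_ge0 // => T /andP[TP _].
  by rewrite mulr_ge0 ?powR_ge0 // ltW // (valid_len_gt0 vP).
rewrite !(eta2_sumE _ _ _ vP) // EP mulrCA ler_pM2l; last first.
  by rewrite powR_gt0 // (valid_len_gt0 vP).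
have E : theta * ((K - 1)^-1 * mass beta P + mass beta P) =
   (theta * K - 1) / (K - 1) * mass beta P + (K - 1)^-1 * mass beta P.
  by field; rewrite subr_eq0 gt_eqF.
have : 0 <= (K - 1)^-1 * mass beta P by rewrite mulr_ge0 // invr_ge0; lra.
rewrite E.
by case: ifP => _; lra.
Qed.

(** Two halves contribute 2 (l/2)^(1 + beta) = 2^-beta l^(1 + beta). *)
Lemma mass_refine k beta P D : valid k P -> (D `<=` P)%fset ->
  mass beta (refine P D) = mass beta P - (1 - 2 `^ (- beta)) * mass beta D.
Proof.
move=> vP DP; have P0 T (TP : T \in P) := valid_len_gt0 vP TP.
rewrite /mass (sum_refine P0 (valid_nonoverlap vP) DP).
congr (_ + _); rewrite -mulNr mulr_sumr [RHS]big_mkcond big_seq [RHS]big_seq.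
apply: eq_bigr => T TD; have TP := fsubsetP DP _ TD.
rewrite (sum_bisect (fun l => l `^ beta * l) vP TP).
case: ifP => _; last by rewrite subrr.
have l0 := valid_len_gt0 vP TP.
rewrite powRM ?invr_ge0 ?ltW // -[2^-1]powR_inv1 // -powRrM mulN1r powR_inv1 //.
by field.
Qed.

Lemma mass_ge k (beta : R) P : 0 <= beta -> valid k P ->
  (2^-1 ^+ k) `^ beta <= mass beta P.
Proof.
move=> b0 vP; have -> : (2^-1 ^+ k) `^ beta =
    (2^-1 ^+ k) `^ beta * \sum_(T <- P | 1 <= T.1) len T.
  by rewrite (valid_len vP) mulr1.
rewrite mulr_sumr /mass.
rewrite big_seq_cond [leRHS]big_seq_cond; apply: ler_sum => T /andP[TP _].
rewrite ler_wpM2r ?(ltW (valid_len_gt0 vP TP)) // ge0_ler_powR ?nnegrE //.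
- exact: ltW (valid_len_gt0 vP TP).
- exact: valid_len_ge vP TP.
Qed.

Lemma mass_le1 k (beta : R) P : 0 <= beta -> valid k P -> mass beta P <= 1.
Proof.
move=> b0 vP; rewrite -(valid_len vP) /mass.
rewrite big_seq_cond [leRHS]big_seq_cond; apply: ler_sum => T /andP[TP _].
have T0 := valid_len_gt0 vP TP.
have [n _ /has_gen_itv[lT _ _ _]] := valid_gen vP TP.
rewrite ler_piMl ?(ltW T0) // -[leRHS](powRr0 (len T)) ger_powR // T0 lT.
by rewrite exprn_ile1 // ?invr_ge0 // invf_le1 // ler1n.
Qed.

Lemma expR_le_fcard k (beta x : R) P : 0 < beta -> valid k P ->
  mass beta P <= expR (- (beta * x)) -> expR x <= #|` P|%:R.
Proof.
move=> b0 vP mP; apply: le_trans (expR_le_card b0 _ (valid_len vP) mP) _.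
  by move=> T TP _; exact: valid_len_gt0 vP TP.
rewrite card_fset_sum1 natr_sum big_mkcond /=.
by apply: ler_sum => T _; case: ifP.
Qed.

(** With alpha = beta = a, both len(T_0)^a and the mass are at least 2^(-a k) >= e^(-a k), and their
    product bounds the square of [delta] from below. *)
Lemma delta_ge k (a K : R) P : 0 < a -> 1 < K -> valid k P ->
  expR (- (a * k%:R)) <= delta a a 1 K P.
Proof.
move=> a0 K1 vP; have [EP _] := elem0P vP.
have e0 : 0 <= expR (- (a * k%:R)) := expR_ge0 _.
rewrite -(ger0_norm e0) -sqrtr_sqr /delta ler_sqrt; last first.
  rewrite (eta2_sumE _ _ _ vP) // EP mulr_ge0 ?powR_ge0 //.
  have m0 : 0 <= mass a P := le_trans (powR_ge0 _ _) (mass_ge (ltW a0) vP).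
  by rewrite addr_ge0 // mulr_ge0 // invr_ge0 subr_ge0 ltW.
have h : expR (- (a * k%:R)) <= (2^-1 ^+ k) `^ a.
  rewrite -mulrN mulrC expRM ge0_ler_powR ?(ltW a0) ?nnegrE ?expR_ge0 //.
  rewrite expRN -[k%:R]mulr1 expRM_natl -exprVn.
  rewrite lerXn2r ?nnegrE ?invr_ge0 ?expR_ge0 //.
  by rewrite lef_pV2 ?posrE ?expR_gt0 //; apply: expR_ge1Dx.
rewrite (eta2_sumE _ _ _ vP) // EP expr2 ler_pM //.
  apply: le_trans h _; rewrite ge0_ler_powR ?(ltW a0) ?nnegrE //.
  - exact: ltW (valid_len_gt0 vP EP).
  - exact: valid_len_ge vP EP.
have mh := le_trans h (mass_ge (ltW a0) vP).
rewrite (le_trans mh) // lerDr mulr_ge0 ?invr_ge0 ?subr_ge0 ?(ltW K1) //.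
exact: le_trans e0 mh.
Qed.

(** * Decay of mass and growth of cardinality along a run *)

Section Run.
Variables (a K theta : R) (P : nat -> {fset elem R}).
Hypotheses (a01 : 0 < a <= 1) (K1 : 1 < K) (Kt : K^-1 < theta)
  (run : adaptive_run a a 1 K theta P).

Lemma run_valid k : valid k (P k).
Proof.
have [P0 step] := run; elim: k => [|k vk].
  by rewrite P0; exact: valid_init.
by have [D [[DP _] _] ->] := step k; exact: valid_refine.
Qed.

Lemma run_mass k :
  mass a (P k) <= expR (- (a * ((theta * K - 1) / (K - 1) / 3 * k%:R))).
Proof.
have [a0 a1] := andP a01; elim: k => [|k IHk].
  by rewrite !mulr0 oppr0 expR0; apply: mass_le1 (ltW a0) (run_valid 0).
have [_ /(_ k)[D [DD _] ->]] := run.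
have := doerfler_mass K1 Kt (run_valid k) DD; set rho := _ / _ => hD.
have rho0 : 0 < rho.
  by rewrite divr_gt0 ?subr_gt0 // -ltr_pdivrMr ?div1r // (lt_trans _ K1).
rewrite (mass_refine _ (run_valid k) DD.1).
have m0 : 0 <= mass a (P k).
  exact: le_trans (powR_ge0 _ _) (mass_ge (ltW a0) (run_valid k)).
have h2 := powR2N_le a01.
(* One step removes at least the fraction (1 - 2^-a) rho >= a rho / 3 of the mass. *)
apply: (@le_trans _ _ (mass a (P k) * (1 - a * (rho / 3)))).
  have mD : 0 <= mass a D := le_trans (mulr_ge0 (ltW rho0) m0) hD.
  have : a / 3 * (rho * mass a (P k)) <= (1 - 2 `^ (- a)) * mass a D.
    by apply: ler_pM => //; [lra|exact: mulr_ge0 (ltW rho0) m0|lra].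
  lra.
have -> : - (a * (rho / 3 * k.+1%:R)) =
    - (a * (rho / 3 * k%:R)) + - (a * (rho / 3)) by rewrite -natr1; ring.
rewrite expRD.
apply: (@le_trans _ _ (mass a (P k) * expR (- (a * (rho / 3))))).
  by rewrite ler_wpM2l //; exact: expR_ge1Dx.
by rewrite ler_pM2r ?expR_gt0.
Qed.

Lemma run_card k : expR ((theta * K - 1) / (K - 1) / 3 * k%:R) <= #|` P k|%:R.
Proof.
have [a0 _] := andP a01.
exact: expR_le_fcard a0 (run_valid k) (run_mass k).
Qed.

End Run.
End Dyadic.

(** * Choice of the parameters and unboundedness *)

Theorem theorem10 (R : realType) (theta s0 : R) (theta_gt0 : 0 < theta)
    (theta_lt1 : theta < 1) (s0_gt0 : 0 < s0) :
  forall epsilon : R, 0 < epsilon ->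
  exists (alpha beta : R) (M : nat) (K : R),
    [/\ 0 < alpha, 0 < beta, (1 <= M)%N & 1 < K] /\
    theta - epsilon < K^-1 < theta /\
    forall P : nat -> {fset R * R},
      adaptive_run alpha beta M K theta P ->
      rate_sup s0 P (fun Q => eta alpha beta M K Q Q) =
        rate_sup s0 P (delta alpha beta M K) /\
      rate_sup s0 P (delta alpha beta M K) = +oo%E.
Proof.
move=> epsilon eps0.
(* The number t becomes 1/K and must be positive, while theta - epsilon may not be: hence two
   cases. *)
have [t /andP[t0 tt] te] : exists2 t, 0 < t < theta & theta - epsilon < t.
  have [h|h] := leP (theta - epsilon) 0; first by exists (theta / 2); lra.
  by exists (theta - epsilon / 2); lra.
pose K := t^-1; have K1 : 1 < K by rewrite invf_gt1 //; lra.
have Kt : K^-1 < theta by rewrite invrK.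
pose c := (theta * K - 1) / (K - 1) / 3.
have c0 : 0 < c.
  by rewrite !divr_gt0 ?subr_gt0 // -ltr_pdivrMr ?div1r // (lt_trans _ K1).
(* The product to bound grows at least like e^((s0 c - a) k); this a leaves the exponent s0 c / 2.
   The cap 1 is for [powR2N_le]. *)
pose a := Num.min 1 (s0 * c / 2).
have a0 : 0 < a by rewrite lt_min ltr01 divr_gt0 // mulr_gt0.
have a1 : a <= 1 by rewrite ge_min lexx.
have ac : a <= s0 * c / 2 by rewrite ge_min lexx orbT.
exists a, a, 1%N, K; split => //; split; first by rewrite invrK te.
move=> P run; split => //; apply/eqyP => A _.
have a01 : 0 < a <= 1 by rewrite a0.
have vP := run_valid run.
(* The first condition makes the initial cardinality at most half of e^(c k), as 1 + y <= e^y. This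
   half costs a factor e at most, which the power s0 turns into the term - s0 of the second. *)
have [k [k1 k2]] : exists k : nat, #|` P 0%N|%:R * 2 <= 1 + c * k%:R /\
   A <= 1 + (s0 * c / 2 * k%:R - s0).
  pose B := `|#|` P 0%N|%:R * 2 / c| + `|(A + s0) / (s0 * c / 2)|.
  have sc : 0 < s0 * c / 2 by rewrite divr_gt0 // mulr_gt0.
  have B0 : 0 <= B by rewrite addr_ge0.
  exists (Num.truncn B).+1.
  have := truncnS_gt B; set k := _%:R => Bk.
  have h1 : #|` P 0%N|%:R * 2 / c <= k.
    by rewrite (le_trans (ler_norm _)) // (le_trans _ (ltW Bk)) // lerDl.
  have h2 : (A + s0) / (s0 * c / 2) <= k.
    by rewrite (le_trans (ler_norm _)) // (le_trans _ (ltW Bk)) // lerDr.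
  by move: h1 h2; rewrite !ler_pdivrMr // => h1 h2; split; lra.
apply: le_trans (ereal_sup_ubound _); last by exists k.
rewrite lee_fin (le_trans k2) //.
have hc : expR (c * k%:R - 1) <= #|` P k|%:R - #|` P 0%N|%:R.
  have hN : expR (c * k%:R) <= #|` P k|%:R := run_card a01 K1 Kt run k.
  have hX := expR_ge1Dx (c * k%:R).
  have : expR (c * k%:R - 1) <= expR (c * k%:R) / 2.
    rewrite expRD ler_pM2l ?expR_gt0 // expRN lef_pV2 ?posrE ?expR_gt0 //.
    exact: expR_ge1Dx.
  by lra.
apply: le_trans (ler_pM (powR_ge0 _ s0) (expR_ge0 _)
  (ge0_ler_powR (ltW s0_gt0) _ _ hc) (delta_ge a0 K1 (vP k))); last 2 first.
- by rewrite nnegrE expR_ge0.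
- by rewrite nnegrE (le_trans _ hc) ?expR_ge0.
rewrite -expRM -expRD; apply: le_trans (expR_ge1Dx _) _.
rewrite ler_expR; have : 0 <= k%:R :> R by [].
by nra.
Qed.
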